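(* Let $C$ be an extended linear code of length $d+1$ over $\mathbb{Z}_N$ and let $g=(g_{ji})$ be a generating matrix of $C$, with $m$ rows and with columns indexed by $i=0,\dots,d$. Put $\gcd_i=\gcd(g_{1i},\dots,g_{mi},N)$. If $C$ is thin and every $\gcd_i=1$ (in particular, if $N$ is prime), then $d\ge N$.
   Context: $\mathbb{Z}_N=\mathbb{Z}/N\mathbb{Z}$; its elements are identified with the representatives $0,1,\dots,N-1$, and gcd's are taken of these integers. A linear code of length $n$ over $\mathbb{Z}_N$ is a submodule $C\subseteq\mathbb{Z}_N^n$; its elements are called words; a generating matrix is a matrix whose rows generate $C$. $C$ is extended if every word has coordinate sum $0\bmod N$. An extended code is thin if it contains no word all of whose entries are nonzero.
   Formalization: N ≥ 2 is assumed (N = 1, d = 0 is a counterexample), and in the case of N prime it is assumed that no column of the generating matrix is zero (the zero code of length 1 is otherwise a counterexample); gcd_i = 1 for all i is then proved. *)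

(* Defs.v *)
From mathcomp Require Import all_boot all_order all_algebra.

Set Implicit Arguments.
Unset Strict Implicit.
Unset Printing Implicit Defensive.

Import GRing.Theory.
Local Open Scope ring_scope.

(* The ring Z/NZ is 'Z_N, whose elements are the ordinals 0, ..., N - 1 as soon
   as 1 < N; outside that range 'Z_N is Z/2Z by convention, so statements about
   Z/NZ must assume 1 < N. *)

Definition linear_code (N n : nat) := submodClosed 'rV['Z_N]_n.

Definition generating_matrix (N m n : nat) (C : linear_code N n)
    (g : 'M['Z_N]_(m, n)) : Prop :=
  forall w : 'rV['Z_N]_n, w \in C <-> exists u : 'rV['Z_N]_m, w = u *m g.

Definition extended (N n : nat) (C : linear_code N n) : Prop :=
  forall w : 'rV['Z_N]_n, w \in C -> \sum_(i < n) w 0 i = 0.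

Definition thin (N n : nat) (C : linear_code N n) : Prop :=
  ~ exists2 w : 'rV['Z_N]_n, w \in C & forall i, w 0 i != 0.

(* The entries are coerced to their representatives 0, ..., N - 1, so this is
   a gcd of natural numbers. *)
Definition column_gcd (N m n : nat) (g : 'M['Z_N]_(m, n)) (i : 'I_n) : nat :=
  gcdn (\big[gcdn/0%N]_(j < m) (g j i : nat)) N.

(* Main.v *)
(* Double counting of the pairs (word of C, zero entry of that word).  Since
   gcd_i = 1, the i-th coordinate maps C onto Z_N, so it vanishes on exactly
   |C| / N words and there are (d + 1) |C| / N pairs.  Thinness gives at least
   one pair per word, hence d + 1 >= N >= 2; the zero word then contributes
   d + 1 > 1 pairs, so the inequality d + 1 >= N is strict. *)
Require Import Defs.
From mathcomp Require Import all_boot all_order all_algebra.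

Set Implicit Arguments.
Unset Strict Implicit.
Unset Printing Implicit Defensive.

Import GRing.Theory.
Local Open Scope ring_scope.

Section Codes.

Variables (N n : nat) (C : linear_code N n).

Lemma entry_gcdn (i : 'I_n) (x y : nat) :
    (exists2 w, w \in C & w 0 i = x%:R) ->
    (exists2 w, w \in C & w 0 i = y%:R) ->
  exists2 w, w \in C & w 0 i = (gcdn x y)%:R.
Proof.
move=> [v vC vi] [w wC wi]; case: (posnP x) => [-> | x_gt0].
  by exists w; rewrite ?gcd0n.
have [a _ /dvdnP[k def_k]] := Bezoutl y x_gt0.
exists (k%:R *: v + (- a%:R) *: w); first by rewrite rpredD ?rpredZ.
by rewrite !mxE vi wi mulNr -!natrM -def_k natrD addrK.
Qed.

Lemma entry_column_gcd (m : nat) (g : 'M['Z_N]_(m, n)) (i : 'I_n) :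
    (1 < N)%N -> generating_matrix C g ->
  exists2 w, w \in C & w 0 i = (column_gcd g i)%:R.
Proof.
move=> N_gt1 g_gen; have C0i : exists2 w, w \in C & w 0 i = 0%:R.
  by exists 0; rewrite ?rpred0 // mxE.
apply: entry_gcdn; last by rewrite pchar_Zp.
elim/big_ind: _ => // [x y|j _]; first exact: entry_gcdn.
exists (row j g); last by rewrite mxE natr_Zp.
by apply/g_gen; exists (delta_mx 0 j); rewrite rowE.
Qed.

Lemma card_entry_eq0 (i : 'I_n) : (1 < N)%N ->
    (exists2 w, w \in C & w 0 i = 1) ->
  #|[set w | w \in C]| = (N * #|[set w | (w \in C) && (w 0%R i == 0%R)]|)%N.
Proof.
move=> N_gt1 [v vC vi].
rewrite -sum1dep_card (partition_big (fun w : 'rV_n => w 0 i) predT) //=.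
transitivity (\sum_(a : 'Z_N) #|[set w | (w \in C) && (w 0%R i == 0%R)]|)%N;
  last by rewrite sum_nat_const; congr (_ * _)%N; rewrite card_ord Zp_cast.
apply: eq_bigr => a _; rewrite -[RHS]sum1dep_card.
rewrite (reindex_inj (addrI (a *: v))); apply: eq_bigl => w.
have avC : a *: v \in C by rewrite rpredZ.
rewrite !mxE vi mulr1 -[X in _ == X]addr0 (inj_eq (addrI a)).
congr (_ && _); apply/idP/idP => wC; last by rewrite rpredD.
have -> : w = (-1) *: (a *: v) + (a *: v + w) by rewrite scaleN1r addKr.
by rewrite rpredD ?rpredZ.
Qed.

Lemma thin_length_gt : (1 < N)%N -> thin C ->
  (forall i, exists2 w, w \in C & w 0 i = 1) -> (N < n)%N.
Proof.
move=> N_gt1 C_thin C1.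
pose W := [set w | w \in C]; pose Z (w : 'rV['Z_N]_n) := #|[set i | w 0 i == 0]|.
have W0 : 0 \in W by rewrite inE rpred0.
have W_gt0 : (0 < #|W|)%N by apply/card_gt0P; exists 0.
have Z0 : Z 0 = n.
  by rewrite /Z -[RHS]card_ord; apply: eq_card => i; rewrite !inE mxE eqxx.
have Z_gt0 w : w \in W -> (0 < Z w)%N.
  rewrite inE lt0n => wC; apply/eqP => /eqP; rewrite cards_eq0 => /eqP Zw0.
  by case: C_thin; exists w => // i; have:= in_set0 i; rewrite -Zw0 inE => ->.
have sumZ : (N * \sum_(w in W) Z w = n * #|W|)%N.
  transitivity (N * \sum_(w in W) \sum_(i < n) (w 0%R i == 0%R))%N.
    congr (_ * _)%N; apply: eq_bigr => w _.
    by rewrite /Z -sum1dep_card big_mkcond.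
  rewrite exchange_big /= big_distrr /=.
  transitivity (\sum_(i < n) #|W|)%N; last by rewrite sum_nat_const card_ord.
  apply: eq_bigr => i _; rewrite (card_entry_eq0 N_gt1 (C1 i)).
  congr (_ * _)%N; rewrite -sum1dep_card -big_mkcondr /=.
  by apply: eq_bigl => w; rewrite inE.
have n_ge : (N <= n)%N.
  by rewrite -(leq_pmul2r W_gt0) -sumZ leq_mul2l -sum1_card leq_sum ?orbT.
rewrite -(ltn_pmul2r W_gt0) -sumZ ltn_mul2l (ltnW N_gt1) -sum1_card.
rewrite (bigD1 0) //= [ltnRHS](bigD1 0) //= Z0 -addSn leq_add //.
  exact: leq_trans n_ge.
by apply: leq_sum => w /andP[/Z_gt0].
Qed.

End Codes.

Lemma column_gcd_prime (N m n : nat) (g : 'M['Z_N]_(m, n)) (i : 'I_n) :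
  prime N -> (exists j, g j i != 0) -> column_gcd g i = 1%N.
Proof.
move=> N_pr [j gji_neq0]; have N_gt1 := prime_gt1 N_pr.
apply/eqP; rewrite -/(coprime _ N) coprime_sym prime_coprime //.
apply: contra gji_neq0 => /dvdn_biggcdP/(_ j isT) N_dv.
by rewrite -[g j i]natr_Zp -Zp_nat_mod // (eqP N_dv).
Qed.

Theorem corollary2p13 (N m d : nat) (N_gt1 : (1 < N)%N)
    (C : linear_code N d.+1) (g : 'M['Z_N]_(m, d.+1))
    (C_ext : extended C) (g_gen : generating_matrix C g) (C_thin : thin C) :
  ((forall i : 'I_d.+1, column_gcd g i = 1%N) -> (N <= d)%N)
  /\ (prime N -> (forall i : 'I_d.+1, exists j : 'I_m, g j i != 0%R) ->
      (forall i : 'I_d.+1, column_gcd g i = 1%N) /\ (N <= d)%N).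
Proof.
have N_le_d : (forall i, column_gcd g i = 1%N) -> (N <= d)%N.
  move=> g1; rewrite -ltnS; apply: (thin_length_gt N_gt1 C_thin) => i.
  by have := entry_column_gcd i N_gt1 g_gen; rewrite g1.
split=> // N_pr g_neq0.
have g1 i : column_gcd g i = 1%N by apply: column_gcd_prime.
by split; last apply: N_le_d.
Qed.
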